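(* Let $\mathcal{H}$ be a separable Hilbert space, let $T_i:\mathcal{H}\to\mathcal{H}$ be $\alpha_i$-averaged for every $i\in I$ with $\alpha_i\le\alpha$ for some $\alpha<1$, and assume $C\ne\emptyset$. Consider the regularity condition (Reg) there exists $\kappa>0$ such that $\operatorname{dist}^2(x,C)\le\kappa R(x)$ for all $x\in\mathcal{H}$. Then (Reg) is satisfied if and only if there exists $r\in[0,1)$ such that $$\mathbb{E}[\operatorname{dist}(T_\xi x,C)]\le r\operatorname{dist}(x,C)\qquad\forall x\in\mathcal{H}.$$ Furthermore, (Reg) is necessary and sufficient for geometric convergence in expectation of the random function iteration to $C$ with a uniform constant for all initial probability measures, i.e. for the existence of a constant $r\in[0,1)$ such that for every initial distribution $\mu$ of $X_0$ the iterates $X_{k+1}=T_{\xi_k}X_k$ satisfy $$\mathbb{E}[\operatorname{dist}(X_{k+1},C)]\le r\,\mathbb{E}[\operatorname{dist}(X_k,C)]\qquad\forall k\in\mathbb{N}_0.$$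
   Context: Setting: $G=\mathcal{H}$ is a Hilbert space with norm $\|\cdot\|$ and Borel $\sigma$-algebra $\mathcal{B}(G)$; $(I,\mathcal{I})$ is a measurable space; $(T_i)_{i\in I}$ is a family of continuous maps $T_i:G\to G$ such that $\Phi:G\times I\to G$, $\Phi(x,i)=T_ix$, is measurable. $(\Omega,\mathcal{F},\mathbb{P})$ is a probability space, $\xi:\Omega\to I$ is measurable, and $(\xi_k)_{k\in\mathbb{N}_0}$ are i.i.d. with the same distribution as $\xi$. For a probability measure $\mu$ on $(G,\mathcal{B}(G))$, $X_0$ is a $G$-valued random variable with law $\mu$, and $X_0,\xi_0,\dots,\xi_k$ are independent for every $k\in\mathbb{N}_0$. The random function iteration is $X_{k+1}=T_{\xi_k}X_k$, $k\in\mathbb{N}_0$. $\operatorname{Fix}T_i=\{x\in G: T_ix=x\}$ and $C:=\{x\in G:\mathbb{P}(x\in\operatorname{Fix}T_\xi)=1\}$; the standing assumption is $C\ne\emptyset$. $R(x):=\mathbb{E}[\|x-T_\xi x\|^2]$ and $\operatorname{dist}(x,C)=\inf_{c\in C}\|x-c\|$. Expectations of nonnegative random variables take values in $[0,\infty]$ (with $0\cdot\infty=0$). A map $T:\mathcal{H}\to\mathcal{H}$ is $\alpha$-averaged, $\alpha\in(0,1)$, if $\|Tx-Ty\|^2+\frac{1-\alpha}{\alpha}\|(x-Tx)-(y-Ty)\|^2\le\|x-y\|^2$ for all $x,y\in\mathcal{H}$. *)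

(* Defs.v *)
From HB Require Import structures.
From mathcomp Require Export all_boot all_order all_algebra.
From mathcomp Require Export all_classical all_reals all_analysis.
Set Implicit Arguments.
Unset Strict Implicit.
Unset Printing Implicit Defensive.
Import Order.TTheory GRing.Theory Num.Theory.
Import numFieldNormedType.Exports.
Local Open Scope classical_set_scope.
Local Open Scope ring_scope.

Definition separable_space (X : topologicalType) : Prop :=
  exists2 D : set X, countable D & dense D.

Definition borel (X : ptopologicalType) := g_sigma_algebraType (@open X).

Section Maps.
Context {R : realType} {H : normedModType R}.

Definition averaged (a : R) (T : H -> H) : Prop :=
  0 < a < 1 /\
  forall x y, `|T x - T y| ^+ 2
    + (1 - a) / a * `|(x - T x) - (y - T y)| ^+ 2 <= `|x - y| ^+ 2.

Definition Fix (T : H -> H) : set H := [set x | T x = x].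

(* The infimum is the intended one only for nonempty C: inf set0 = 0. *)
Definition dist (x : H) (C : set H) : R := inf [set `|x - c| | c in C].

End Maps.

Section Probability.
Context {R : realType} {d : measure_display} {Omega : measurableType d}.
Variable P : probability Omega R.

Definition mutually_independent (J : eqType) (F : J -> set_system Omega) : Prop :=
  forall (s : seq J) (A : J -> set Omega),
    uniq s -> (forall j, j \in s -> F j (A j)) ->
    P (\bigcap_(j in [set` s]) A j) = (\prod_(j <- s) P (A j))%E.

Context {d' : measure_display} {E : measurableType d'}.

Definition sigma_of (X : Omega -> E) : set_system Omega :=
  preimage_set_system setT X measurable.

(* Equality is required on measurable sets only, because a measure is a
   function on all sets whose values off the sigma-algebra are irrelevant. *)
Definition has_law (X : {RV P >-> E}) (mu : set E -> \bar R) : Prop :=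
  forall A, measurable A -> distribution P X A = mu A.

Definition iid_with_law_of (xi : {RV P >-> E}) (xi_ : nat -> {RV P >-> E}) : Prop :=
  (forall k, has_law (xi_ k) (distribution P xi)) /\
  mutually_independent (fun k => sigma_of (xi_ k)).

End Probability.

Section RandomFunctionIteration.
Context {R : realType} {H : normedModType R}.
Context {d dI : measure_display} {Omega : measurableType d} {I : measurableType dI}.
Variable P : probability Omega R.

(* X_0, xi_0, ..., xi_k are independent for every k: the index None stands for
   X_0, and every finite subfamily lies in the first k.+1 of the xi's for
   some k. *)
Definition independent_start (X0 : {RV P >-> borel H})
    (xi_ : nat -> {RV P >-> I}) : Prop :=
  mutually_independent P (fun j : option nat =>
    if j is Some k then sigma_of (xi_ k) else sigma_of X0).

Definition admissible_start (mu : probability (borel H) R)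
    (xi_ : nat -> {RV P >-> I}) (X0 : {RV P >-> borel H}) : Prop :=
  has_law X0 mu /\ independent_start X0 xi_.

Variable T : I -> H -> H.

Fixpoint rfi (xi_ : nat -> Omega -> I) (X0 : Omega -> H) (k : nat) (w : Omega) : H :=
  if k is k'.+1 then T (xi_ k' w) (rfi xi_ X0 k' w) else X0 w.

Definition feasible_set (xi : Omega -> I) : set H :=
  [set x | P [set w | x \in Fix (T (xi w))] = 1%E].

Definition residual (xi : Omega -> I) (x : H) : \bar R :=
  'E_P[fun w => `|x - T (xi w) x| ^+ 2].

Definition regular (xi : Omega -> I) : Prop :=
  exists2 kappa : R, 0 < kappa & forall x : H,
    ((dist x (feasible_set xi) ^+ 2)%:E <= kappa%:E * residual xi x)%E.

End RandomFunctionIteration.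

(* Main.v *)
(* Integrating the averagedness inequality at a point c of C gives
     E[dist(T_xi x, C)^2] + (1 - alpha) / alpha * R(x) <= |x - c|^2;
   taking the infimum over c, (Reg) and Cauchy-Schwarz yield the one-step
   contraction, without any projection onto C. Conversely, the contraction and
   dist(x, C) <= |x - T_xi x| + dist(T_xi x, C) bound (1 - r) dist(x, C) by
   E|x - T_xi x|. The iterates inherit the one-step contraction because X_k is
   independent of xi_k, and Dirac initial laws recover it. *)
Require Import Defs.
From mathcomp Require Import measurable_realfun lra.
Set Implicit Arguments.
Unset Strict Implicit.
Unset Printing Implicit Defensive.
Import Order.TTheory GRing.Theory Num.Theory.
Import numFieldNormedType.Exports.
Local Open Scope classical_set_scope.
Local Open Scope ring_scope.

(** * Distance to a set, and Borel measurability of continuous functions *)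

Section Distance.
Context {R : realType} {H : normedModType R}.
Implicit Types (x y c : H) (C : set H).

Lemma dist_ge0 x C : 0 <= dist x C.
Proof.
(* The empty set is covered by the default value of [inf], which is 0. *)
have [->|C0] := eqVneq C set0; first by rewrite /dist image_set0 inf0.
apply: lb_le_inf => [|_ [c _ <-]//].
by case/set0P: C0 => c Cc; exists `|x - c|, c.
Qed.

Lemma dist_le x c C : C c -> dist x C <= `|x - c|.
Proof.
by move=> Cc; apply: ge_inf; [exists 0 => _ [? _ <-] | exists c].
Qed.

Lemma le_dist C x a : C !=set0 -> (forall c, C c -> a <= `|x - c|) ->
  a <= dist x C.
Proof.
move=> [c Cc] aC; apply: lb_le_inf; first by exists `|x - c|, c.
by move=> _ [c' Cc' <-]; exact: aC.
Qed.

Lemma dist_triangle C x y : C !=set0 -> dist x C <= `|x - y| + dist y C.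
Proof.
move=> C0; rewrite -lerBlDl; apply: le_dist => // c Cc.
by rewrite lerBlDl (le_trans (dist_le x Cc))// ler_distD.
Qed.

Lemma dist_continuous C : C !=set0 -> continuous (dist ^~ C).
Proof.
move=> C0 x; apply/cvgrPdist_le => e e0; near=> y.
have xy : `|x - y| <= e by near: y; apply: cvgr_dist_le.
rewrite ler_distlC; apply/andP; split.
  by rewrite lerBlDl (le_trans (dist_triangle x y C0))// lerD2r.
by rewrite (le_trans (dist_triangle y x C0))// addrC lerD2l distrC.
Unshelve. all: by end_near. Qed.

(** Open intervals generate the Borel sets of the line, and their preimages under [f] are open,
    hence generators of [borel H]. *)
Lemma continuous_borel_measurable (f : H -> R) : continuous f ->
  measurable_fun [set: borel H] (f : borel H -> R).
Proof.
move=> /continuousP cf; apply: (measurability _ (RGenOpens.measurableE R)).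
move=> _ [_ [a [b ->] <-]]; rewrite setTI.
by apply: sub_sigma_algebra; apply: cf; exact: interval_open.
Qed.

End Distance.

(** * First and second moments under a probability measure *)

Section SecondMoment.
Context {R : realType} d {Omega : measurableType d} (P : probability Omega R).
Context (f : Omega -> R) (f0 : forall w, 0 <= f w).
Context (mf : measurable_fun setT f).

(** This form of Cauchy-Schwarz comes from integrating 2 a f <= f^2 + a^2, which allows infinite
    expectations. *)
Lemma sqr_le_expectation (a : R) : 0 <= a ->
  (a%:E <= 'E_P[f])%E -> ((a ^+ 2)%:E <= 'E_P[fun w => (f w ^+ 2)%R])%E.
Proof.
move=> a0; rewrite !unlock => af.
(* With a^2 added on both sides the claim reads 2 a^2 <= E[f^2 + a^2], so that only nonnegative
   functions are integrated. *)
rewrite -(@leeD2rE _ (a ^+ 2)%:E)//.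
have -> : (a ^+ 2)%:E = (\int[P]_w (a ^+ 2)%:E)%E.
  by rewrite integral_cst//= probability_setT mule1.
rewrite -[leRHS]ge0_integralD//=; last 3 first.
- by move=> w _; rewrite lee_fin sqr_ge0.
- exact/measurable_EFinP/measurable_funX.
- by move=> w _; rewrite lee_fin sqr_ge0.
apply: (@le_trans _ _ (\int[P]_w ((2 * a)%:E * (f w)%:E))%E).
  rewrite ge0_integralZl//; last 3 first.
  - exact/measurable_EFinP.
  - by move=> w _; rewrite lee_fin.
  - by rewrite lee_fin mulr_ge0.
  rewrite integral_cst//= probability_setT mule1.
  have -> : ((a ^+ 2)%:E + (a ^+ 2)%:E = (2 * a)%:E * a%:E :> \bar R)%E.
    by rewrite -EFinD -EFinM; congr EFin; lra.
  by apply: lee_wpmul2l => //; rewrite lee_fin mulr_ge0.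
apply: ge0_le_integral => //=.
- by move=> w _; rewrite -EFinM lee_fin !mulr_ge0.
- by apply/measurable_EFinP; apply: measurable_funM.
- by apply/measurable_EFinP; apply: measurable_funD => //; exact: measurable_funX.
- move=> w _; rewrite -EFinM -EFinD lee_fin -subr_ge0.
  by rewrite (_ : _ - _ = (f w - a) ^+ 2) ?sqr_ge0//; lra.
Qed.

Lemma expectation_le_of_sqr (b : R) : 0 <= b ->
  ('E_P[fun w => (f w ^+ 2)%R] <= (b ^+ 2)%:E)%E -> ('E_P[f] <= b%:E)%E.
Proof.
move=> b0 fb; rewrite leNgt; apply/negP => bf.
(* The previous lemma takes a real lower bound, while E f may be [+oo]; in that case b + 1
   serves. *)
have [a ba af] : exists2 a, b < a & (a%:E <= 'E_P[f])%E.
  move: bf; case: ('E_P[f])%E => [r|_|//].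
  - by rewrite lte_fin => br; exists r.
  - by exists (b + 1); rewrite ?leey// ltrDl.
have a0 : 0 <= a by rewrite (le_trans b0)// ltW.
have := le_trans (sqr_le_expectation a0 af) fb.
by rewrite lee_fin ler_sqr// leNgt ba.
Qed.

End SecondMoment.

(** * A single random step: regularity against contraction *)

Section OneStep.
Context {R : realType} {H : normedModType R}.
Context {dI : measure_display} {I : measurableType dI} (T : I -> H -> H).
Context (T_measurable :
  measurable_fun [set: borel H * I] (fun p : borel H * I => T p.2 p.1 : borel H)).
Context {d : measure_display} {Omega : measurableType d}.
Context (P : probability Omega R) (xi : {RV P >-> I}).

Local Notation C := (feasible_set P T xi).

Lemma step_measurable x :
  measurable_fun setT (fun w => T (xi w) x : borel H).
Proof.
have mxi : measurable_fun setT xi by exact: measurable_funPT.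
exact: (measurableT_comp (measurable_fun_pair2 (x : borel H) T_measurable) mxi).
Qed.

Lemma step_dist_measurable x y :
  measurable_fun setT (fun w => `|y - T (xi w) x|).
Proof.
have cy : continuous (fun z : H => `|y - z|).
  by move=> z; apply: cvg_norm; apply: cvgB; [exact: cvg_cst | exact: cvg_id].
exact: (measurableT_comp (continuous_borel_measurable cy) (step_measurable x)).
Qed.

Lemma feasible_ae c : C c -> \forall w \ae P, T (xi w) c = c.
Proof.
move=> Cc; have mA : measurable [set w | T (xi w) c = c].
  (* The event is the zero set of a measurable real function; its measurability turns probability
     one into a negligible complement. *)
  rewrite -[X in measurable X]setTI (_ : [set w | T (xi w) c = c] =
    (fun w => `|c - T (xi w) c|) @^-1` [set 0]).
    by apply: step_dist_measurable => //; exact: measurable_set1.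
  apply/seteqP; split=> w /=; first by move->; rewrite subrr normr0.
  by move=> /eqP; rewrite normr_eq0 subr_eq0 => /eqP.
apply/negligibleP; first exact: measurableC.
rewrite /= probability_setC//.
have -> : [set w | T (xi w) c = c] = [set w | c \in Fix (T (xi w))].
  by apply/seteqP; split=> w /=; rewrite /Fix inE.
by rewrite Cc subee.
Qed.

Context (C_nonempty : C !=set0).

Lemma dist_step_measurable x : measurable_fun setT (fun w => dist (T (xi w) x) C).
Proof.
have mC := continuous_borel_measurable (dist_continuous C_nonempty).
exact: (measurableT_comp mC (step_measurable x)).
Qed.

Lemma contraction_regular :
  (exists2 r : R, 0 <= r < 1 & forall x : H,
     ('E_P[fun w => dist (T (xi w) x) C] <= r%:E * (dist x C)%:E)%E) ->
  regular P T xi.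
Proof.
move=> [r /andP[r0 r1] rC]; have s0 : 0 < 1 - r by rewrite subr_gt0.
(* This constant arises from squaring (1 - r) dist(x, C) <= E|x - T_xi x|. *)
exists ((1 - r) ^- 2); first by rewrite invr_gt0 exprn_gt0.
move=> x; rewrite lee_pdivlMl ?exprn_gt0//.
rewrite -EFinM -exprMn; apply: sqr_le_expectation => //.
- exact: step_dist_measurable.
- by rewrite mulr_ge0 ?dist_ge0// ltW.
rewrite mulrBl mul1r EFinB leeBlDr//.
apply: (@le_trans _ _ ('E_P[fun w => `|x - T (xi w) x|%R] +
                       'E_P[fun w => dist (T (xi w) x) C]))%E; last first.
  by rewrite EFinM leeD2l.
rewrite !unlock -ge0_integralD//=; last 3 first.
- exact/measurable_EFinP/step_dist_measurable.
- by move=> w _; rewrite lee_fin dist_ge0.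
- exact/measurable_EFinP/dist_step_measurable.
have -> : ((dist x C)%:E = \int[P]_w (dist x C)%:E)%E.
  by rewrite integral_cst//= probability_setT mule1.
apply: ge0_le_integral => //=.
- by move=> w _; rewrite lee_fin dist_ge0.
- apply/measurable_EFinP/measurable_funD; first exact: step_dist_measurable.
  exact: dist_step_measurable.
- by move=> w _; rewrite -EFinD lee_fin dist_triangle.
Qed.

Context (alpha_ : I -> R) (alpha : R).
Context (T_averaged : forall i, averaged (alpha_ i) (T i)).
Context (alpha_le : forall i, alpha_ i <= alpha).

(** Since (1 - a) / a = 1/a - 1 decreases in a > 0, [alpha_ i] can be replaced by [alpha], which
    makes the coefficient independent of [i] before integration. *)
Lemma averaged_fixed_point i x c : T i c = c ->
  `|T i x - c| ^+ 2 + (1 - alpha) / alpha * `|x - T i x| ^+ 2 <= `|x - c| ^+ 2.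
Proof.
move=> Tc; have [/andP[a0 a1] /(_ x c)] := T_averaged i.
rewrite Tc subrr subr0; apply: le_trans; rewrite lerD2l ler_wpM2r ?sqr_ge0//.
have b0 : 0 < alpha by rewrite (lt_le_trans a0).
rewrite !mulrBl !mul1r !divff ?gt_eqF// lerD2r lef_pV2 ?posrE//.
Qed.

(** The point [c] is fixed only almost surely, so the inequality is integrated almost everywhere.
    Bounding |T_xi x - c| below by the distance frees the left side of [c], ready for the
    infimum. *)
Lemma mean_square_step x c : alpha < 1 -> 0 < alpha -> C c ->
  ('E_P[fun w => (dist (T (xi w) x) C ^+ 2)%R] +
   ((1 - alpha) / alpha)%:E * residual P T xi x <= (`|x - c| ^+ 2)%:E)%E.
Proof.
move=> a1 a0 Cc; have b0 : 0 <= (1 - alpha) / alpha.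
  by rewrite divr_ge0// ?subr_ge0 ltW.
rewrite /residual !unlock -ge0_integralZl//; last first.
  exact/measurable_EFinP/measurable_funX/step_dist_measurable.
rewrite -ge0_integralD//; last 4 first.
- by move=> w _; rewrite lee_fin sqr_ge0.
- exact/measurable_EFinP/measurable_funX/dist_step_measurable.
- by move=> w _; rewrite -EFinM lee_fin mulr_ge0 ?sqr_ge0.
- apply/measurable_EFinP/measurable_funM => //.
  exact/measurable_funX/step_dist_measurable.
have -> : ((`|x - c| ^+ 2)%:E = \int[P]_w (`|x - c| ^+ 2)%:E)%E.
  by rewrite integral_cst//= probability_setT mule1.
apply: ae_ge0_le_integral => //=.
- move=> w _; rewrite -EFinM -EFinD lee_fin addr_ge0 ?sqr_ge0//.
  by rewrite mulr_ge0 ?sqr_ge0.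
- apply/measurable_EFinP/measurable_funD.
    exact/measurable_funX/dist_step_measurable.
  apply: measurable_funM => //.
  exact/measurable_funX/step_dist_measurable.
apply: filterS (feasible_ae Cc) => w Tc _.
rewrite -EFinM -EFinD lee_fin (le_trans _ (averaged_fixed_point x Tc))//.
by rewrite lerD2r ler_sqr ?nnegrE ?dist_ge0// dist_le.
Qed.

Lemma regular_contraction : alpha < 1 -> regular P T xi ->
  exists2 r : R, 0 <= r < 1 & forall x : H,
    ('E_P[fun w => dist (T (xi w) x) C] <= r%:E * (dist x C)%:E)%E.
Proof.
move=> a1 [k k0 reg].
(* Any index yields positivity; [I] is inhabited by [point]. *)
have a0 : 0 < alpha.
  by have [/andP[a0 _] _] := T_averaged point; rewrite (lt_le_trans a0).
set b := (1 - alpha) / alpha.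
have b0 : 0 < b by rewrite divr_gt0 ?subr_gt0.
(* As s k = (1 - alpha) / alpha, (Reg) bounds the residual term below by s dist(x, C)^2. This leaves
   the factor 1 - s for the mean square, hence its square root for the mean; if 1 - s is negative,
   [Num.sqrt] returns 0. *)
pose s := b / k; have s0 : 0 < s by rewrite divr_gt0.
exists (Num.sqrt (1 - s)).
  rewrite sqrtr_ge0 /= -[ltRHS]sqrtr1 ltr_sqrt// ltrBlDr ltrDl//.
move=> x; rewrite -EFinM; apply: expectation_le_of_sqr.
- by move=> w; exact: dist_ge0.
- exact: dist_step_measurable.
- by rewrite mulr_ge0 ?sqrtr_ge0 ?dist_ge0.
have E0 : (0 <= 'E_P[fun w => (dist (T (xi w) x) C ^+ 2)%R])%E.
  by apply: expectation_ge0 => w; exact: sqr_ge0.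
have EC c : C c -> ('E_P[fun w => (dist (T (xi w) x) C ^+ 2)%R] +
    (s * dist x C ^+ 2)%:E <= (`|x - c| ^+ 2)%:E)%E.
  move=> Cc; apply: le_trans (mean_square_step x a1 a0 Cc).
  rewrite leeD2l// EFinM (_ : (_ / alpha)%:E = s%:E * k%:E)%E; last first.
    by rewrite -EFinM divfK// gt_eqF.
  by rewrite -muleA; apply: lee_wpmul2l (reg x); rewrite lee_fin ltW.
(* The mean square is finite, being bounded by |x - c|^2 for some [c] in C. *)
move: E0 EC; case: ('E_P[_])%E => [e|_ /=|//]; last first.
  by case: C_nonempty => c Cc /(_ c Cc).
rewrite lee_fin => e0 EC.
(* [dist] is an infimum of norms, not of their squares, so the infimum over [c] is taken after
   extracting the root of the left side. *)
have eC : e + s * dist x C ^+ 2 <= dist x C ^+ 2.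
  have h0 : 0 <= e + s * dist x C ^+ 2.
    by rewrite addr_ge0// mulr_ge0 ?sqr_ge0// ltW.
  rewrite -[leLHS]sqr_sqrtr// ler_sqr ?nnegrE ?sqrtr_ge0 ?dist_ge0//.
  apply: le_dist => // c Cc; rewrite -[leRHS]normr_id -sqrtr_sqr.
  by rewrite ler_sqrt ?sqr_ge0// -lee_fin EFinD EC.
rewrite lee_fin exprMn; have [s1|s1] := leP s 1.
  by rewrite sqr_sqrtr ?subr_ge0// mulrBl mul1r lerBrDr.
(* For s > 1 it suffices that e <= 0, which [eC] forces. *)
rewrite (le_trans _ (mulr_ge0 (sqr_ge0 _) (sqr_ge0 _)))//.
have : (s - 1) * dist x C ^+ 2 >= 0.
  by rewrite mulr_ge0 ?sqr_ge0// subr_ge0 ltW.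
by lra.
Qed.

End OneStep.

(** * Product laws, and independence from the future *)

Section Independence.
Context {R : realType} {d : measure_display} {Omega : measurableType d}.
Context (P : probability Omega R).
Context {d1 d2 : measure_display} {E : measurableType d1} {I : measurableType d2}.

Lemma pair_event_independent (X : {RV P >-> E}) (Y : {RV P >-> I})
    (D : set Omega) (mD : measurable D) :
  (forall A B, measurable A -> measurable B ->
     P (X @^-1` A `&` Y @^-1` B) = (P (X @^-1` A) * P (Y @^-1` B))%E) ->
  (forall A B, measurable A -> measurable B ->
     P (X @^-1` A `&` Y @^-1` B `&` D) =
     (P (X @^-1` A) * (P D * P (Y @^-1` B)))%E) ->
  forall Z, measurable Z ->
    P ((fun w => (X w, Y w)) @^-1` Z `&` D) =
    (P D * P ((fun w => (X w, Y w)) @^-1` Z))%E.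
Proof.
(* As functions of Z, both sides are the product of the law of X with P D times
   the law of Y, since they agree with it on rectangles. *)
move=> XY XYD Z mZ.
have mpair : measurable_fun setT (fun w => (X w, Y w)).
  by apply: measurable_fun_pair; exact: measurable_funPT.
pose pair : {mfun Omega >-> (E * I)%type} := mfun_Sub (mem_set mpair).
have PD_fin : P D \is a fin_num by exact: fin_num_measure.
have PD0 : 0 <= fine (P D) by rewrite fine_ge0.
pose q := NngNum PD0.
have qE : (q%:num%:E = P D)%E by rewrite -[RHS](fineK PD_fin).
pose muX : {sigma_finite_measure set E -> \bar R} := distribution P X.
pose muY : {sigma_finite_measure set I -> \bar R} := mscale q (distribution P Y).
pose m1 : {measure set (E * I) -> \bar R} := pushforward (mrestr P mD) pair.
pose m2 : {measure set (E * I) -> \bar R} := mscale q (distribution P pair).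
have m1E : (muX \x muY)%E Z = m1 mpair Z.
  apply: product_measure_unique => // A B mA mB.
  by rewrite /= /mscale qE -XYD.
have m2E : (muX \x muY)%E Z = m2 Z.
  apply: product_measure_unique => // A B mA mB.
  by rewrite /= /mscale qE muleCA -XY.
transitivity (m1 mpair Z); first by [].
by rewrite -m1E m2E /= /mscale qE.
Qed.

(** A change of variables identifies this map with the section integral of Tonelli's theorem for the
    law of [Y]. *)
Lemma expectation_section_measurable (Y : {RV P >-> I}) (f : E * I -> R) :
  measurable_fun setT f -> (forall z, 0 <= f z) ->
  measurable_fun setT (fun x => 'E_P[fun w => f (x, Y w)])%E.
Proof.
move=> mf f0; have mfE := (measurable_EFinP _ _).2 mf.
have fE0 z : (0 <= (EFin \o f) z)%E by rewrite lee_fin.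
pose muY : {sigma_finite_measure set I -> \bar R} := distribution P Y.
have := @measurable_fun_fubini_tonelli_F _ _ _ _ _ muY _ mfE fE0.
congr (measurable_fun _ _); apply/funext => x.
rewrite /fubini_F ge0_integral_distribution// ?unlock//.
exact: (measurable_fun_pair2 x mfE).
Qed.

(** Factorization on rectangles makes the joint law the product of the marginals; Tonelli then
    integrates [Y] out with [X] frozen. *)
Lemma expectation_independent_pair (X : {RV P >-> E}) (Y : {RV P >-> I})
    (f : E * I -> R) :
  measurable_fun setT f -> (forall z, 0 <= f z) ->
  (forall A B, measurable A -> measurable B ->
     P (X @^-1` A `&` Y @^-1` B) = (P (X @^-1` A) * P (Y @^-1` B))%E) ->
  ('E_P[fun w => f (X w, Y w)] =
   \int[distribution P X]_x 'E_P[fun w => f (x, Y w)])%E.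
Proof.
move=> mf f0 XY; rewrite unlock.
have mfE := (measurable_EFinP _ _).2 mf.
have fE0 z : (0 <= (EFin \o f) z)%E by rewrite lee_fin.
have mpair : measurable_fun setT (fun w => (X w, Y w)).
  by apply: measurable_fun_pair; exact: measurable_funPT.
pose pair : {mfun Omega >-> (E * I)%type} := mfun_Sub (mem_set mpair).
pose muX : {sigma_finite_measure set E -> \bar R} := distribution P X.
pose muY : {sigma_finite_measure set I -> \bar R} := distribution P Y.
transitivity (\int[distribution P pair]_z (EFin \o f) z)%E.
  by rewrite ge0_integral_distribution.
transitivity (\int[muX \x muY]_z (EFin \o f) z)%E.
  apply: eq_measure_integral => Z mZ _; apply/esym.
  by apply: product_measure_unique => // A B mA mB; rewrite -XY.
rewrite (fubini_tonelli1 _ mfE fE0).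
apply: eq_integral => x _; rewrite /fubini_F ge0_integral_distribution//.
exact: (measurable_fun_pair2 x mfE).
Qed.

(** This is the invariant carried along the iteration. It includes the mutual independence of the
    tail itself (take A = [setT]), and [X] is a bare function so that composites fit without
    repackaging. *)
Definition independent_of_tail (X : Omega -> E) (xi_ : nat -> {RV P >-> I})
    (k : nat) : Prop :=
  forall (s : seq nat) (A : set E) (B : nat -> set I),
    uniq s -> all (leq k) s -> measurable A -> (forall j, measurable (B j)) ->
    P (X @^-1` A `&` \big[setI/setT]_(j <- s) (xi_ j @^-1` B j)) =
    (P (X @^-1` A) * \prod_(j <- s) P (xi_ j @^-1` B j))%E.

Lemma independent_of_tail_head X xi_ k : independent_of_tail X xi_ k ->
  forall A B, measurable A -> measurable B ->
    P (X @^-1` A `&` xi_ k @^-1` B) = (P (X @^-1` A) * P (xi_ k @^-1` B))%E.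
Proof.
move=> Xk A B mA mB; have := Xk [:: k] A (fun=> B) isT _ mA (fun=> mB).
by rewrite !big_seq1; apply; rewrite /= leqnn.
Qed.

(** The new state depends on the pair (X, xi_k) alone. Independence of that pair from an event [D]
    of later variables needs checking only on rectangles, where it is the hypothesis for the indices
    k :: s. *)
Lemma independent_of_tail_step (X : {RV P >-> E}) xi_ k
    (F : E * I -> E) (mF : measurable_fun setT F) :
  independent_of_tail X xi_ k ->
  independent_of_tail (fun w => F (X w, xi_ k w)) xi_ k.+1.
Proof.
move=> Xk s A B us sk mA mB.
have ks : k \notin s.
  by apply/negP => /(allP sk); rewrite ltnn.
have sk' : all (leq k) s by apply: sub_all sk => j; exact: ltnW.
pose D := \big[setI/setT]_(j <- s) (xi_ j @^-1` B j).
have mD : measurable D.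
  apply: bigsetI_measurable => j _.
  by rewrite -[X in measurable X]setTI; exact: measurable_funPT.
have PD : P D = (\prod_(j <- s) P (xi_ j @^-1` B j))%E.
  have := Xk s setT B us sk' measurableT mB.
  by rewrite preimage_setT setTI probability_setT mul1e.
rewrite -PD -/D muleC.
apply: (@pair_event_independent X (xi_ k) D mD _ _ (F @^-1` A)).
- exact: independent_of_tail_head.
- move=> A' B' mA' mB'.
  (* [B''] prescribes [B'] at index [k] and changes nothing on [s], which does not contain [k]. *)
  pose B'' j := if j == k then B' else B j.
  have mB'' j : measurable (B'' j) by rewrite /B''; case: ifP.
  have eqs j : j \in s -> B'' j = B j.
    by move=> js; rewrite /B''; case: eqP => // jk; rewrite -jk js in ks.
  have DE : \big[setI/setT]_(j <- s) (xi_ j @^-1` B'' j) = D.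
    by apply: eq_big_seq => j /eqs ->.
  have PDE : (\prod_(j <- s) P (xi_ j @^-1` B'' j) = P D)%E.
    by rewrite PD; apply: eq_big_seq => j /eqs ->.
  have Bk : B'' k = B' by rewrite /B'' eqxx.
  have := Xk (k :: s) A' B'' _ _ mA' mB''.
  rewrite /= ks us leqnn sk' !big_cons => /(_ isT isT).
  by rewrite DE PDE setIA Bk [(P D * _)%E]muleC.
- by rewrite -[X in measurable X]setTI; exact: mF.
Qed.

End Independence.

(** * The random function iteration and its initial laws *)

Section Iteration.
Context {R : realType} {H : normedModType R}.
Context {dI : measure_display} {I : measurableType dI} (T : I -> H -> H).
Context (T_measurable :
  measurable_fun [set: borel H * I] (fun p : borel H * I => T p.2 p.1 : borel H)).
Context {d : measure_display} {Omega : measurableType d}.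
Context (P : probability Omega R) (xi : {RV P >-> I}) (xi_ : nat -> {RV P >-> I}).
Context (xi_law : forall k, has_law (xi_ k) (distribution P xi)).

Lemma expectation_eq_law k (f : I -> R) : measurable_fun setT f ->
  (forall i, 0 <= f i) ->
  ('E_P[fun w => f (xi_ k w)] = 'E_P[fun w => f (xi w)])%E.
Proof.
move=> mf f0; have mfE := (measurable_EFinP _ _).2 mf.
have fE0 z : (0 <= (EFin \o f) z)%E by rewrite lee_fin.
rewrite !unlock -(ge0_integral_distribution (xi_ k) mfE fE0).
rewrite -(ge0_integral_distribution xi mfE fE0).
by apply: eq_measure_integral => A mA _; exact: xi_law.
Qed.

Lemma rfi_measurable (X0 : {RV P >-> borel H}) k :
  measurable_fun setT (rfi T xi_ X0 k : Omega -> borel H).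
Proof.
elim: k => [|k IHk] /=; first exact: measurable_funPT.
have mpair : measurable_fun setT
    (fun w => (rfi T xi_ X0 k w : borel H, xi_ k w)).
  by apply: measurable_fun_pair => //; exact: measurable_funPT.
exact: (measurableT_comp T_measurable mpair).
Qed.

(** X_k involves only X_0 and the variables of index below [k]: the base case is the independence of
    the start, and each iteration consumes one variable. *)
Lemma rfi_independent_of_tail (X0 : {RV P >-> borel H}) k :
  independent_start X0 xi_ ->
  independent_of_tail (rfi T xi_ X0 k : Omega -> borel H) xi_ k.
Proof.
move=> X0xi; elim: k => [|k IHk].
  move=> s A B us _ mA mB.
  (* The event for X_0 sits at index [None], matching the encoding in [independent_start]. *)
  pose G (j : option nat) :=
    if j is Some k then xi_ k @^-1` B k else X0 @^-1` A.
  have := X0xi (None :: map Some s) G _ _.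
  rewrite bigcap_seq !big_cons !big_map; apply.
    rewrite /= map_inj_uniq ?us ?andbT; last by move=> ? ? [].
    by apply/negP => /mapP[].
  by move=> [j|] _ /=; [exists (B j) | exists A] => //; rewrite setTI.
pose Xk : {RV P >-> borel H} := mfun_Sub (mem_set (rfi_measurable X0 k)).
exact: (@independent_of_tail_step _ _ _ _ _ _ _ _ Xk xi_ k _ T_measurable IHk).
Qed.

Context (C : set H) (C_nonempty : C !=set0).

Local Notation step := (fun x => 'E_P[fun w => dist (T (xi w) x) C])%E.

Lemma dist_step_joint_measurable :
  measurable_fun setT (fun z : borel H * I => dist (T z.2 z.1) C).
Proof.
have mC := continuous_borel_measurable (dist_continuous C_nonempty).
exact: (measurableT_comp mC T_measurable).
Qed.

Lemma step_expectation_measurable :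
  measurable_fun setT (step : borel H -> \bar R).
Proof.
apply: (expectation_section_measurable xi dist_step_joint_measurable) => z.
exact: dist_ge0.
Qed.

Lemma step_expectation_ge0 x : (0 <= step x)%E.
Proof. by apply: expectation_ge0 => w; exact: dist_ge0. Qed.

Lemma dist_rfi_measurable (X0 : {RV P >-> borel H}) k :
  measurable_fun setT (fun w => dist (rfi T xi_ X0 k w) C).
Proof.
have mC := continuous_borel_measurable (dist_continuous C_nonempty).
exact: (measurableT_comp mC (rfi_measurable X0 k)).
Qed.

(** A Markov property without conditional expectations: xi_k is independent of X_k and is integrated
    out first, then replaced by [xi], which has the same law. *)
Lemma expectation_rfi_step (X0 : {RV P >-> borel H}) k :
  independent_start X0 xi_ ->
  ('E_P[fun w => dist (rfi T xi_ X0 k.+1 w) C] =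
   \int[P]_w step (rfi T xi_ X0 k w))%E.
Proof.
move=> X0xi.
pose Xk : {RV P >-> borel H} := mfun_Sub (mem_set (rfi_measurable X0 k)).
have f0 (z : borel H * I) : 0 <= dist (T z.2 z.1) C by exact: dist_ge0.
have XY := independent_of_tail_head (rfi_independent_of_tail (k := k) X0xi).
rewrite (expectation_independent_pair (X := Xk) (Y := xi_ k)
  dist_step_joint_measurable f0 XY).
(* Both sides become integrals against the law of X_k and are compared pointwise. *)
rewrite -(ge0_integral_distribution Xk step_expectation_measurable
  step_expectation_ge0).
apply: eq_integral => x _; have mfx := measurable_fun_pair2 x
  dist_step_joint_measurable.
by apply: (expectation_eq_law k mfx) => i; exact: dist_ge0.
Qed.

(** The pointwise bound is integrated along X_k; all integrands are nonnegative, so infinite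
    expectations are allowed. *)
Lemma rfi_contraction (r : R) : 0 <= r ->
  (forall x, step x <= r%:E * (dist x C)%:E)%E ->
  forall X0 : {RV P >-> borel H}, independent_start X0 xi_ ->
  forall k, ('E_P[fun w => dist (rfi T xi_ X0 k.+1 w) C]
              <= r%:E * 'E_P[fun w => dist (rfi T xi_ X0 k w) C])%E.
Proof.
move=> r0 rC X0 X0xi k; rewrite expectation_rfi_step// [in leRHS]unlock.
have mdist := (measurable_EFinP _ _).2 (dist_rfi_measurable X0 k).
rewrite -ge0_integralZl//; last by move=> w _; rewrite lee_fin dist_ge0.
apply: ge0_le_integral => //.
- by move=> w _; exact: step_expectation_ge0.
- exact: (measurableT_comp step_expectation_measurable (rfi_measurable X0 k)).
- exact: measurable_funeM.
Qed.

(** Under a Dirac initial law, integrating a function of X_0 evaluates it at [x], so the bound for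
    the first iteration is the pointwise one. *)
Lemma contraction_of_rfi (r : R) (x : H) (X0 : {RV P >-> borel H}) :
  has_law X0 (\d_(x : borel H)) -> independent_start X0 xi_ ->
  ('E_P[fun w => dist (rfi T xi_ X0 1 w) C]
     <= r%:E * 'E_P[fun w => dist (rfi T xi_ X0 0 w) C])%E ->
  (step x <= r%:E * (dist x C)%:E)%E.
Proof.
move=> X0x X0xi; rewrite expectation_rfi_step//.
have X0E (f : borel H -> \bar R) : measurable_fun setT f ->
    (forall y, 0 <= f y)%E -> (\int[P]_w f (X0 w) = f x)%E.
  move=> mf f0; rewrite -(ge0_integral_distribution X0 mf f0).
  rewrite (eq_measure_integral (\d_(x : borel H))); last first.
    by move=> A mA _; exact: X0x.
  by rewrite integral_dirac// diracT mul1e.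
have mC := continuous_borel_measurable (dist_continuous C_nonempty).
have -> : (\int[P]_w step (rfi T xi_ X0 0 w) = step x)%E.
  exact: (X0E _ step_expectation_measurable step_expectation_ge0).
have -> // : ('E_P[fun w => dist (rfi T xi_ X0 0 w) C] = (dist x C)%:E)%E.
rewrite unlock; apply: (X0E (fun y => (dist y C)%:E)).
- exact/measurable_EFinP.
- by move=> y; rewrite lee_fin dist_ge0.
Qed.

End Iteration.

Theorem theorem3p15 (R : realType) (H : completeNormedModType R)
  (dot : {dot H for idfun}) (dot_norm : forall x : H, dot x x = `|x| ^+ 2)
  (H_separable : separable_space H)
  (dI : measure_display) (I : measurableType dI)
  (T : I -> H -> H)
  (T_continuous : forall i, continuous (T i))
  (T_measurable :
    measurable_fun [set: borel H * I] (fun p : borel H * I => T p.2 p.1 : borel H))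
  (d : measure_display) (Omega : measurableType d) (P : probability Omega R)
  (xi : {RV P >-> I}) (xi_ : nat -> {RV P >-> I})
  (xi_iid : iid_with_law_of xi xi_)
  (start_exists : forall mu : probability (borel H) R,
    exists X0 : {RV P >-> borel H}, admissible_start mu xi_ X0)
  (alpha_ : I -> R) (alpha : R)
  (T_averaged : forall i, averaged (alpha_ i) (T i))
  (alpha_le : forall i, alpha_ i <= alpha) (alpha_lt1 : alpha < 1)
  (C_nonempty : feasible_set P T xi !=set0) :
  let C := feasible_set P T xi in
  (regular P T xi <->
    exists2 r : R, 0 <= r < 1 & forall x : H,
      ('E_P[fun w => dist (T (xi w) x) C] <= r%:E * (dist x C)%:E)%E) /\
  (regular P T xi <->
    exists2 r : R, 0 <= r < 1 &
      forall (mu : probability (borel H) R) (X0 : {RV P >-> borel H}),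
        admissible_start mu xi_ X0 ->
        forall k : nat,
          ('E_P[fun w => dist (rfi T xi_ X0 k.+1 w) C]
            <= r%:E * 'E_P[fun w => dist (rfi T xi_ X0 k w) C])%E).
Proof.
have [xi_law _] := xi_iid.
move=> C; have reg := @regular_contraction _ _ _ _ _ T_measurable _ _ P xi
  C_nonempty _ _ T_averaged alpha_le alpha_lt1.
have contr := @contraction_regular _ _ _ _ _ T_measurable _ _ P xi C_nonempty.
split; first by split.
split=> [/reg[r r01 rC]|[r r01 rC]].
  exists r => // mu X0 [_ X0xi] k; have [r0 _] := andP r01.
  exact: (rfi_contraction T_measurable xi_law C_nonempty).
(* The bound quantifies over all starts with a given law; [start_exists] provides one for the Dirac
   law, so the bound is not vacuous there. *)
apply: contr; exists r => // x.
have [X0 X0x] := start_exists (\d_(x : borel H)).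
have [law_X0 X0xi] := X0x.
exact: (contraction_of_rfi T_measurable xi_law C_nonempty law_X0 X0xi
  (rC _ _ X0x 0%N)).
Qed.
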